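(* Let $(X,\leqslant,\rho)$ be a finite graded poset with minimum and maximum and with a good decomposition $X=A\times B$, and let $f\in[\rho]$ be induced by $g\in[\rho_B]$. Then $$\mathrm{Im}(\rho-f)=\mathrm{Im}(\rho_B-g).$$ In particular, if $\sum_{x\in X}q^{\rho(x)}$ and $\sum_{b\in B}q^{\rho_B(b)}$ are reciprocal polynomials, then $$k^-(\rho,f)=2\rho_A(\hat 1_A)+k^-(\rho_B,g).$$
   Context: Let $(X,\leqslant,\rho)$ be a finite graded poset with minimum $\hat 0$, maximum $\hat 1$ and rank function $\rho$ (with $\rho(\hat 0)=0$). $F(X)$ is the ring of functions $X\to\mathbb{Z}$; $\mathrm{Im}(f)=\{f(x):x\in X\}$. Functions $f,g\in F(X)$ are equidistributed if $\sum_{x\in X}q^{f(x)}=\sum_{x\in X}q^{g(x)}$ in $\mathbb{N}[q,q^{-1}]$. Write $f\sim g$ if $f,g$ are equidistributed, $f(\hat 0)=g(\hat 0)$ and $f(\hat 1)=g(\hat 1)$; $[f]$ denotes the $\sim$-equivalence class of $f$ (similarly for other finite graded posets with minimum and maximum). A polynomial $P\in\mathbb{Z}[q]$ of degree $k$ is reciprocal if $q^kP(q^{-1})=P(q)$. For a finite graded poset $Y$ with minimum and maximum and $f,g\in F(Y)$, $$k^-(f,g):=|\{f(x)-g(y):x,y\in Y\}|-|\mathrm{Im}(f-g)|-1 .$$ Decompositions: suppose the underlying set of $X$ is (in bijection with) a cartesian product $A\times B$, with projections $\pi_A,\pi_B$. The sets $A$ and $B$ carry the partial orders induced from $\leqslant$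 on $X$, for which all inclusions $a\mapsto(a,b)$ ($b\in B$ fixed) and $b\mapsto(a,b)$ ($a\in A$ fixed) are order preserving (so the order on $X$ is a refinement of the product order; $\pi_A,\pi_B$ need not be order preserving), and $\hat 0=(\hat 0_A,\hat 0_B)$, $\hat 1=(\hat 1_A,\hat 1_B)$, where $\hat 0_A,\hat 1_A$ (resp. $\hat 0_B,\hat 1_B$) are the minimum and maximum of $A$ (resp. $B$). Put $\rho_A(a)=\rho(a,\hat 0_B)$ and $\rho_B(b)=\rho(\hat 0_A,b)$. The decomposition is good if $(A,\leqslant,\rho_A)$ and $(B,\leqslant,\rho_B)$ are graded posets (with rank functions $\rho_A,\rho_B$) and $\rho=\rho_A\circ\pi_A+\rho_B\circ\pi_B$. For a good decomposition, put $R(f)=f-\rho_A\circ\pi_A$ for $f\in F(X)$. A function $f\in[\rho]$ is induced by $g\in F(B)$ if $g\in[\rho_B]$ and $R(f)=g\circ\pi_B$. *)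

(* Defs.v *)
From HB Require Import structures.
From mathcomp Require Import all_boot all_order all_algebra.
From mathcomp Require Import fraction finmap.

Set Implicit Arguments.
Unset Strict Implicit.
Unset Printing Implicit Defensive.

Import Order.TTheory GRing.Theory Num.Theory.

Local Open Scope ring_scope.

Section GradedPosets.
Context {d : Order.disp_t} {Y : finTBPOrderType d}.

Definition covered_by (x y : Y) : bool :=
  (x < y)%O && ~~ [exists z, (x < z < y)%O].

Definition rank_function (rho : Y -> nat) : Prop :=
  rho \bot%O = 0%N /\ forall x y, covered_by x y -> rho y = (rho x).+1.

Definition rankF (rho : Y -> nat) : Y -> int := fun x => (rho x)%:Z.

Definition Imf (f : Y -> int) : {fset int} := [fset f x | x in Y]%fset.

(* Z[q, q^-1] is viewed inside the fraction field of Z[q]. *)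
Definition qvar : {fraction {poly int}} := tofrac 'X.

Definition equidistributed (f g : Y -> int) : Prop :=
  \sum_x qvar ^ f x = \sum_x qvar ^ g x.

Definition sim (f g : Y -> int) : Prop :=
  [/\ equidistributed f g, f \bot%O = g \bot%O & f \top%O = g \top%O].

Definition rank_poly (rho : Y -> nat) : {poly int} := \sum_x 'X^(rho x).

Definition kminus (f g : Y -> int) : int :=
  (#|` [fset (f x - g y)%R | x in Y, y in Y]%fset|)%:Z
  - (#|` Imf (f \- g)|)%:Z - 1.

End GradedPosets.

(* q^k P(q^-1) = P(q) with k = deg P, computed in Frac(Z[q]). *)
Definition reciprocal (P : {poly int}) : Prop :=
  qvar ^+ (size P).-1 * (map_poly intr P).[qvar^-1] = (map_poly intr P).[qvar].

(* The order induced on a factor is the largest one making all the inclusions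
   of that factor order preserving.  If the order restricted to a single slice
   (such as the one through \bot) already makes all inclusions order
   preserving, then it is this order. *)
Record decomposition {d dA dB : Order.disp_t} (X : finTBPOrderType d)
    (A : finTBPOrderType dA) (B : finTBPOrderType dB) := Decomposition {
  dpair : A -> B -> X;
  piA : X -> A;
  piB : X -> B;
  piA_dpair : forall a b, piA (dpair a b) = a;
  piB_dpair : forall a b, piB (dpair a b) = b;
  dpair_pi : forall x, dpair (piA x) (piB x) = x;
  leA_induced : forall a a' : A,
    (a <= a')%O <-> (forall b, dpair a b <= dpair a' b)%O;
  leB_induced : forall b b' : B,
    (b <= b')%O <-> (forall a, dpair a b <= dpair a b')%O;
  dpair_bot : dpair \bot%O \bot%O = \bot%O;
  dpair_top : dpair \top%O \top%O = \top%O
}.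

Section Decompositions.
Context {d dA dB : Order.disp_t} {X : finTBPOrderType d}
  {A : finTBPOrderType dA} {B : finTBPOrderType dB}.
Variables (D : decomposition X A B) (rho : X -> nat).

Definition rankA (a : A) : nat := rho (dpair D a \bot%O).
Definition rankB (b : B) : nat := rho (dpair D \bot%O b).

Definition good_decomposition : Prop :=
  [/\ rank_function rankA, rank_function rankB &
      forall x, rho x = (rankA (piA D x) + rankB (piB D x))%N].

Definition Rmap (f : X -> int) : X -> int := f \- (rankF rankA \o piA D).

Definition induced_by (f : X -> int) (g : B -> int) : Prop :=
  [/\ sim f (rankF rho), sim g (rankF rankB) & Rmap f =1 g \o piB D].

End Decompositions.

(* Main.v *)
Require Import Defs.
From HB Require Import structures.
From mathcomp Require Import all_boot all_order all_algebra.
From mathcomp Require Import fraction finmap.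
From mathcomp Require Import zify.

Import Order.TTheory GRing.Theory Num.Theory.
Local Open Scope ring_scope.

(** Since rho = rho_A o pi_A + rho_B o pi_B and f = rho_A o pi_A + g o pi_B, the
    contributions of A cancel in rho - f, which is therefore (rho_B - g) o pi_B;
    as pi_B is onto, rho - f and rho_B - g have the same image.

    For the second formula, the image of a rank function rho on any finite
    bounded poset Y is the whole interval of integers from 0 to n = rho(1):
    climbing along covers from any element reaches the maximum and raises the
    rank by exactly one at each step ([rank_onto]).  A function equidistributed
    with rho has the same image ([equidistributed_Imf]), so its differences with
    rho fill the interval from -n to n, which has 2n + 1 elements
    ([card_rank_differences]).  Hence k^- is 2n minus the size of an image which
    is the same on X and on B, and the two values of n differ by rho_A(1).  *)

Section GradedImage.
Context {d : Order.disp_t} {Y : finTBPOrderType d}.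

Lemma exists_cover (x : Y) : x != \top%O -> exists y, covered_by x y.
Proof.
move=> x_neq_top; have lt_x_top : (x < \top)%O by rewrite lt_neqAle x_neq_top lex1.
(* A y > x for which the interval ]x, y] is smallest covers x: a z strictly
   between them would give the smaller interval ]x, z]. *)
case: (arg_minnP (fun y : Y => #|[pred z | x < z <= y]%O|) lt_x_top).
move=> y lt_xy y_min; exists y; rewrite /covered_by lt_xy /=.
apply/existsP => -[z /andP[lt_xz lt_zy]].
have := y_min z lt_xz; rewrite leqNgt => /negP; apply; apply: proper_card.
apply/properP; split.
  by apply/subsetP => t; rewrite !inE => /andP[-> /le_trans ->] //; exact: ltW.
by exists y; rewrite !inE ?lt_xy ?lexx // lt_geF.
Qed.

(** The bound and the surjectivity come from the same upward induction: both
    pass from a cover of x, whose rank is one more, to x itself. *)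
Lemma rank_onto_above (rho : Y -> nat) (x : Y) : rank_function rho ->
  (rho x <= rho \top%O)%N /\
  forall k, (rho x <= k <= rho \top%O)%N -> exists y, rho y = k.
Proof.
move=> [_ rho_cover].
have [n] := ubnP #|[pred z | x < z]%O|; elim: n x => // n IHn x lt_xn.
have [->|/exists_cover[y cover_xy]] := eqVneq x \top%O.
  by split=> // k bounds_k; exists \top%O; lia.
have lt_xy : (x < y)%O by case/andP: cover_xy.
have rho_y := rho_cover _ _ cover_xy.
have [|rho_y_le rho_y_onto] := IHn y.
  rewrite -ltnS; apply: leq_trans lt_xn; rewrite ltnS; apply: proper_card.
  apply/properP; split.
    by apply/subsetP => t; rewrite !inE; apply: lt_trans.
  by exists y; rewrite !inE ?ltxx.
split=> [|k bounds_k]; first by lia.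
have [<-|rho_x_neq_k] := eqVneq (rho x) k; first by exists x.
by apply: rho_y_onto; lia.
Qed.

Lemma rank_le_top (rho : Y -> nat) (x : Y) :
  rank_function rho -> (rho x <= rho \top%O)%N.
Proof. by case/(rank_onto_above rho x). Qed.

Lemma rank_onto (rho : Y -> nat) (k : nat) :
  rank_function rho -> (k <= rho \top%O)%N -> exists y, rho y = k.
Proof.
move=> rho_rank le_k; have [_] := rank_onto_above rho \bot%O rho_rank; apply.
by case: rho_rank => ->.
Qed.

Lemma qvar_neq0 : qvar != 0.
Proof. by rewrite /qvar tofrac_eq0 polyX_eq0. Qed.

Lemma qvar_shift (N : nat) (f : Y -> int) : (forall x, `|f x| <= N)%N ->
  qvar ^ (N%:Z) * \sum_x qvar ^ f x = tofrac (\sum_x 'X^(`|(N%:Z + f x)%R|%N)).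
Proof.
move=> f_bounded; rewrite mulr_sumr rmorph_sum; apply: eq_bigr => x _.
rewrite -expfzDr ?qvar_neq0 // rmorphXn /=.
suff -> : N%:Z + f x = `|(N%:Z + f x)%R|%N by [].
by have := f_bounded x; lia.
Qed.

(** Multiplied by a high power of q, the two Laurent polynomials become genuine
    polynomials, and the coefficient of q^(N + k) counts the fibre over k. *)
Lemma equidistributed_fibres (f g : Y -> int) (k : int) :
  equidistributed f g -> #|[pred x | f x == k]| = #|[pred x | g x == k]|.
Proof.
move=> eq_fg.
pose N := (`|k| + (\sum_x `|f x| + \sum_x `|g x|))%N.
have f_le x : (`|f x| <= N)%N.
  by rewrite /N (bigD1 x) //=; lia.
have g_le x : (`|g x| <= N)%N.
  by rewrite /N [X in (_ + (_ + X))%N](bigD1 x) //=; lia.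
have k_le : (`|k| <= N)%N by rewrite /N leq_addr.
have fibre (h : Y -> int) : (forall x, `|h x| <= N)%N ->
    (\sum_x 'X^(`|(N%:Z + h x)%R|%N) : {poly int})`_(`|(N%:Z + k)%R|%N)
      = #|[pred x | h x == k]|%:R.
  move=> h_le; rewrite coef_sum -sum1_card natr_sum [RHS]big_mkcond /=.
  apply: eq_bigr => x _; rewrite coefXn inE.
  have -> : (`|(N%:Z + k)%R|%N == `|(N%:Z + h x)%R|%N) = (h x == k).
    by have := h_le x; lia.
  by case: eqP.
apply/eqP; rewrite -(eqr_nat int) -!fibre //; apply/eqP; congr (nth 0 (polyseq _) _).
by apply/eqP; rewrite -tofrac_eq -!qvar_shift // eq_fg.
Qed.

Lemma equidistributed_Imf (f g : Y -> int) : equidistributed f g -> Imf f = Imf g.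
Proof.
move=> eq_fg; apply/fsetP => k.
have mem_Imf (h : Y -> int) : (k \in Imf h) = (0 < #|[pred x | h x == k]|)%N.
  apply/imfsetP/card_gt0P => [[x _ ->]|[x /eqP <-]]; exists x => //.
  by rewrite inE.
by rewrite !mem_Imf (equidistributed_fibres _ _ k eq_fg).
Qed.

Lemma card_rank_differences (rho : Y -> nat) (f : Y -> int) :
  rank_function rho -> equidistributed f (rankF rho) ->
  #|` [fset (rankF rho x - f y)%R | x in Y, y in Y]%fset|
    = (2 * rho \top%O).+1.
Proof.
move=> rho_rank /equidistributed_Imf eq_Im; set n := rho \top%O.
have f_onto y : exists z, rankF rho z = f y.
  have : f y \in Imf f by apply/imfsetP; exists y.
  by rewrite eq_Im => /imfsetP[z _ ->]; exists z.
have onto_f z : exists y, f y = rankF rho z.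
  have : rankF rho z \in Imf (rankF rho) by apply/imfsetP; exists z.
  by rewrite -eq_Im => /imfsetP[y _ ->]; exists y.
(* The interval from -n to n, enumerated by i |-> i - n. *)
have -> : [fset (rankF rho x - f y)%R | x in Y, y in Y]%fset
        = [fset ((nat_of_ord i)%:Z - n%:Z)%R | i in 'I_(2 * n).+1]%fset.
  apply/fsetP => k; apply/imfset2P/imfsetP.
    move=> [x _ [y _ ->]]; have [z <-] := f_onto y.
    have := rank_le_top rho x rho_rank; have := rank_le_top rho z rho_rank.
    rewrite /rankF -/n => le_z le_x.
    have lt_i : (rho x + n - rho z < (2 * n).+1)%N by lia.
    by exists (Ordinal lt_i) => //=; lia.
  move=> [i _ ->]; have lt_i := ltn_ord i.
  (* i - n = i - n when i <= n, and i - n = n - (2n - i) when i >= n; both are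
     differences of numbers between 0 and n. *)
  have [x rho_x] := rank_onto rho (minn i n) rho_rank (geq_minr _ _).
  have [z rho_z] : exists z, rho z = (minn i n + n - i)%N.
    by apply: rank_onto rho_rank _; rewrite -/n; lia.
  have [y f_y] := onto_f z.
  by exists x => //; exists y => //; rewrite f_y /rankF rho_x rho_z; lia.
rewrite card_imfset /= ?size_enum_ord -?cardE ?card_ord //.
by move=> i j /addIr[/val_inj].
Qed.

Lemma kminus_rank (rho : Y -> nat) (f : Y -> int) :
  rank_function rho -> equidistributed f (rankF rho) ->
  kminus (rankF rho) f
    = 2 * (rho \top%O)%:Z - #|` Imf (rankF rho \- f)|%:Z.
Proof. by move=> rho_rank eq_f; rewrite /kminus card_rank_differences //; lia. Qed.

End GradedImage.

Theorem theorem3p9 (d dA dB : Order.disp_t) (X : finTBPOrderType d)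
  (A : finTBPOrderType dA) (B : finTBPOrderType dB)
  (rho : X -> nat) (D : decomposition X A B) (f : X -> int) (g : B -> int) :
  rank_function rho ->
  good_decomposition D rho ->
  induced_by D rho f g ->
  Imf (rankF rho \- f) = Imf (rankF (rankB D rho) \- g) /\
  (reciprocal (rank_poly rho) ->
   reciprocal (rank_poly (rankB D rho)) ->
   kminus (rankF rho) f =
     2 * (rankA D rho \top%O)%:Z + kminus (rankF (rankB D rho)) g).
Proof.
move=> rho_rank [_ rhoB_rank rho_sum] [[eq_f _ _] [eq_g _ _] f_ind].
have diffE x : rankF rho x - f x = rankF (rankB D rho) (piB D x) - g (piB D x).
  by have := f_ind x; rewrite /Rmap /rankF /= rho_sum; lia.
have eq_Im : Imf (rankF rho \- f) = Imf (rankF (rankB D rho) \- g).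
  apply/fsetP => k; apply/imfsetP/imfsetP => -[] => [x _ ->|b _ ->].
    by exists (piB D x); rewrite //= diffE.
  by exists (dpair D \bot%O b); rewrite //= diffE piB_dpair.
split=> // _ _; rewrite !kminus_rank // eq_Im.
have -> : rho \top%O = (rankA D rho \top%O + rankB D rho \top%O)%N.
  by rewrite rho_sum -(dpair_top D) piA_dpair piB_dpair.
by lia.
Qed.
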